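(* If $L=\langle \omega,\wedge,\vee,0,1,\leq_L\rangle$ is an effectively inseparable pre-lattice, then the pre-ordering relation $\leq_L$ is universal; that is, $\leq_L$ is c.e. and for every c.e. pre-ordering relation $R$ on $\omega$ there is a computable function $f:\omega\to\omega$ such that for all $x,y$, $x\mathrel{R}y$ if and only if $f(x)\leq_L f(y)$.
   Context: $W_u$ denotes the $u$-th c.e. set. A pre-ordering relation is a reflexive transitive relation on $\omega$; it is c.e. if it is c.e. as a set of pairs. All pre-orders are assumed non-trivial (the quotient by the induced equivalence relation has more than one element). A c.e. pre-lattice is a structure $L=\langle\omega,\wedge,\vee,\leq_L\rangle$ with $\wedge,\vee$ computable binary operations and $\leq_L$ a c.e. pre-ordering relation, such that the equivalence relation $\equiv_L$ ($x\equiv_L y$ iff $x\leq_L y$ and $y\leq_L x$) is a congruence and the quotient $L/{\equiv_L}$, ordered by the partial order induced by $\leq_L$, is a lattice in which $\wedge$ and $\vee$ induce meet and join. Distributivity is not assumed. A c.e. bounded pre-lattice $\langle\omega,\wedge,\vee,0,1,\leq_L\rangle$ is a c.e. pre-lattice in which $[0]_L$ and $[1]_L$ (the $\equiv_L$-classes of $0$ and $1$) are the least and greatest elements of the quotient. A disjoint pair $(A,B)$ of sets is effectively inseparable (e.i.) if there is a partial computable function $\phi(u,v)$ (a productive function) such that whenever $A\subseteq W_u$, $B\subseteq W_v$ and $W_u\cap W_v=\emptyset$, then $\phi(u,v)$ is defined and $\phi(u,v)\notin W_u\cup W_v$. An effectively inseparable (e.i.) pre-lattice is a c.e. bounded pre-lattice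 $L$ such that the pair $([0]_L,[1]_L)$ is e.i. *)

(* Defs.v *)
From Stdlib Require Import Arith Lia Cantor.

(** Partial recursive functions are presented as unary functions on [nat];
    several arguments are passed through the Cantor pairing bijection. *)

Definition pr (x y : nat) : nat := Cantor.to_nat (x, y).
Definition pi1 (n : nat) : nat := fst (Cantor.of_nat n).
Definition pi2 (n : nat) : nat := snd (Cantor.of_nat n).

Inductive code : Type :=
| Zero : code
| Succ : code
| Fst : code
| Snd : code
| Pair : code -> code -> code
| Comp : code -> code -> code
| Prec : code -> code -> code
| Mu : code -> code.

(** [eval c x y] is the graph of the partial function computed by [c].
    [Prec f g] maps [pr a n] to [h a n], where [h a 0 = f a] and
    [h a (S n) = g (pr a (pr n (h a n)))].  [Mu f] maps [x] to the least [y]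
    such that [f (pr x y) = 0], provided [f] is defined at all earlier
    [pr x m]. *)
Fixpoint eval (c : code) (x y : nat) {struct c} : Prop :=
  match c with
  | Zero => y = 0
  | Succ => y = S x
  | Fst => y = pi1 x
  | Snd => y = pi2 x
  | Pair f g => exists a b, eval f x a /\ eval g x b /\ y = pr a b
  | Comp f g => exists z, eval g x z /\ eval f z y
  | Prec f g =>
      nat_rect (fun _ => nat -> Prop)
        (eval f (pi1 x))
        (fun n h z => exists w, h w /\ eval g (pr (pi1 x) (pr n w)) z)
        (pi2 x) y
  | Mu f =>
      eval f (pr x y) 0 /\
      forall m, m < y -> exists k, eval f (pr x m) (S k)
  end.

Lemma eval_functional (c : code) :
  forall x y z, eval c x y -> eval c x z -> y = z.
Proof.
  induction c as [ | | | | f IHf g IHg | f IHf g IHg | f IHf g IHg | f IHf];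
    simpl; intros x y z Hy Hz; try congruence.
  - destruct Hy as (a & b & Ha & Hb & ->).
    destruct Hz as (a' & b' & Ha' & Hb' & ->).
    now rewrite (IHf _ _ _ Ha Ha'), (IHg _ _ _ Hb Hb').
  - destruct Hy as (a & Ha & Hy). destruct Hz as (b & Hb & Hz).
    rewrite (IHg _ _ _ Hb Ha) in Hz. eauto.
  - revert y z Hy Hz. induction (pi2 x) as [ | n IHn]; simpl; intros y z Hy Hz.
    + eauto.
    + destruct Hy as (a & Ha & Hy). destruct Hz as (b & Hb & Hz).
      rewrite (IHn _ _ Hb Ha) in Hz. eauto.
  - destruct Hy as [Hy Ly], Hz as [Hz Lz].
    destruct (Nat.lt_trichotomy y z) as [H | [H | H]]; [ | exact H | ].
    + destruct (Lz _ H) as [k Hk]. discriminate (IHf _ _ _ Hy Hk).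
    + destruct (Ly _ H) as [k Hk]. discriminate (IHf _ _ _ Hz Hk).
Qed.

(** Every number [u = pr t p] is the index of a program: [t] selects the
    constructor and [p] carries its arguments.  Arguments of a constructor
    have indices smaller than [u], so [u] itself is enough fuel. *)
Fixpoint decode_fuel (k u : nat) : code :=
  match k with
  | 0 => Zero
  | S k =>
      let p := pi2 u in
      match pi1 u with
      | 0 => Zero
      | 1 => Succ
      | 2 => Fst
      | 3 => Snd
      | 4 => Pair (decode_fuel k (pi1 p)) (decode_fuel k (pi2 p))
      | 5 => Comp (decode_fuel k (pi1 p)) (decode_fuel k (pi2 p))
      | 6 => Prec (decode_fuel k (pi1 p)) (decode_fuel k (pi2 p))
      | _ => Mu (decode_fuel k p)
      end
  end.

Definition decode (u : nat) : code := decode_fuel u u.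

Fixpoint encode (c : code) : nat :=
  match c with
  | Zero => pr 0 0
  | Succ => pr 1 0
  | Fst => pr 2 0
  | Snd => pr 3 0
  | Pair f g => pr 4 (pr (encode f) (encode g))
  | Comp f g => pr 5 (pr (encode f) (encode g))
  | Prec f g => pr 6 (pr (encode f) (encode g))
  | Mu f => pr 7 (encode f)
  end.

Lemma pi1_pr (x y : nat) : pi1 (pr x y) = x.
Proof. unfold pi1, pr. now rewrite Cantor.cancel_of_to. Qed.

Lemma pi2_pr (x y : nat) : pi2 (pr x y) = y.
Proof. unfold pi2, pr. now rewrite Cantor.cancel_of_to. Qed.

Lemma pr_pi (n : nat) : pr (pi1 n) (pi2 n) = n.
Proof.
  unfold pi1, pi2, pr. rewrite <- surjective_pairing.
  apply Cantor.cancel_to_of.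
Qed.

Lemma pr_ge (x y : nat) : x + y <= pr x y.
Proof. unfold pr. pose proof (Cantor.to_nat_non_decreasing x y). lia. Qed.

Lemma decode_encode (c : code) : decode (encode c) = c.
Proof.
  enough (H : forall k, encode c <= k -> decode_fuel k (encode c) = c)
    by (now apply H).
  induction c as [ | | | | f IHf g IHg | f IHf g IHg | f IHf g IHg | f IHf];
    intros [ | k] Hk; simpl encode in *; try reflexivity;
    match goal with
    | H : pr ?t ?p <= _ |- _ => pose proof (pr_ge t p)
    end; try lia;
    simpl decode_fuel; rewrite ?pi1_pr, ?pi2_pr; try reflexivity;
    try (pose proof (pr_ge (encode f) (encode g));
         rewrite ?pi1_pr, ?pi2_pr, IHf, IHg by lia; reflexivity).
  rewrite IHf by lia. reflexivity.
Qed.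

Lemma decode_unfold (u : nat) :
  decode u =
  let p := pi2 u in
  match pi1 u with
  | 0 => Zero
  | 1 => Succ
  | 2 => Fst
  | 3 => Snd
  | 4 => Pair (decode (pi1 p)) (decode (pi2 p))
  | 5 => Comp (decode (pi1 p)) (decode (pi2 p))
  | 6 => Prec (decode (pi1 p)) (decode (pi2 p))
  | _ => Mu (decode p)
  end.
Proof.
  assert (D : forall k l v, v <= k -> v <= l ->
            decode_fuel k v = decode_fuel l v).
  { induction k as [ | k IHk]; intros [ | l] v Hk Hl; try reflexivity;
      try (replace v with 0 by lia; reflexivity).
    simpl. pose proof (pr_ge (pi1 v) (pi2 v)) as H. rewrite pr_pi in H.
    pose proof (pr_ge (pi1 (pi2 v)) (pi2 (pi2 v))) as H'. rewrite pr_pi in H'.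
    destruct (pi1 v) as [ | [ | [ | [ | [ | [ | [ | t]]]]]]]; try reflexivity;
      rewrite ?(IHk l (pi1 (pi2 v))), ?(IHk l (pi2 (pi2 v))),
        ?(IHk l (pi2 v)) by lia; reflexivity. }
  destruct u as [ | u]; [reflexivity | ].
  unfold decode at 1. cbn [decode_fuel]. unfold decode.
  set (v := S u) in *. pose proof (pr_ge (pi1 v) (pi2 v)) as H.
  rewrite pr_pi in H.
  pose proof (pr_ge (pi1 (pi2 v)) (pi2 (pi2 v))) as H'. rewrite pr_pi in H'.
  cbv zeta.
  destruct (pi1 v) as [ | [ | [ | [ | [ | [ | [ | t]]]]]]]; try reflexivity;
    rewrite ?(D u (pi1 (pi2 v)) (pi1 (pi2 v))),
      ?(D u (pi2 (pi2 v)) (pi2 (pi2 v))),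
      ?(D u (pi2 v) (pi2 v)) by lia; reflexivity.
Qed.

Definition W (u x : nat) : Prop := exists y, eval (decode u) x y.

Definition computable (f : nat -> nat) : Prop :=
  exists c, forall x y, eval c x y <-> y = f x.

Definition computable2 (f : nat -> nat -> nat) : Prop :=
  exists c, forall x y z, eval c (pr x y) z <-> z = f x y.

(** [phi u v z] is the graph of a binary partial function. *)
Definition partial_computable2 (phi : nat -> nat -> nat -> Prop) : Prop :=
  exists c, forall u v z, phi u v z <-> eval c (pr u v) z.

Definition ce_rel (R : nat -> nat -> Prop) : Prop :=
  exists u, forall x y, R x y <-> W u (pr x y).

Definition equiv_of (R : nat -> nat -> Prop) (x y : nat) : Prop :=
  R x y /\ R y x.

(** Pre-orderings are non-trivial by convention: the quotient by the induced
    equivalence relation has more than one element. *)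
Record preordering (R : nat -> nat -> Prop) : Prop := {
  preord_refl : forall x, R x x;
  preord_trans : forall x y z, R x y -> R y z -> R x z;
  preord_nontrivial : exists x y, ~ equiv_of R x y
}.

(** The quotient is not formed: that it is a lattice whose meet and join are
    induced by [meet] and [join] is written out on representatives. *)
Record ce_prelattice (meet join : nat -> nat -> nat)
    (le : nat -> nat -> Prop) : Prop := {
  meet_computable : computable2 meet;
  join_computable : computable2 join;
  le_ce : ce_rel le;
  le_preordering : preordering le;
  meet_congr : forall x x' y y', equiv_of le x x' -> equiv_of le y y' ->
    equiv_of le (meet x y) (meet x' y');
  join_congr : forall x x' y y', equiv_of le x x' -> equiv_of le y y' ->
    equiv_of le (join x y) (join x' y');
  meet_lower_l : forall x y, le (meet x y) x;
  meet_lower_r : forall x y, le (meet x y) y;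
  meet_greatest : forall x y z, le z x -> le z y -> le z (meet x y);
  join_upper_l : forall x y, le x (join x y);
  join_upper_r : forall x y, le y (join x y);
  join_least : forall x y z, le x z -> le y z -> le (join x y) z
}.

(** The distinguished elements [bot] and [top] are arbitrary numbers, not
    necessarily the numbers [0] and [1]. *)
Record ce_bounded_prelattice (meet join : nat -> nat -> nat)
    (bot top : nat) (le : nat -> nat -> Prop) : Prop := {
  bounded_prelattice : ce_prelattice meet join le;
  bot_least : forall x, le bot x;
  top_greatest : forall x, le x top
}.

Definition disjoint (A B : nat -> Prop) : Prop := forall x, ~ (A x /\ B x).

Definition subset (A B : nat -> Prop) : Prop := forall x, A x -> B x.

Definition effectively_inseparable (A B : nat -> Prop) : Prop :=
  disjoint A B /\
  exists phi, partial_computable2 phi /\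
    forall u v, subset A (W u) -> subset B (W v) -> disjoint (W u) (W v) ->
      exists z, phi u v z /\ ~ (W u z \/ W v z).

Definition ei_prelattice (meet join : nat -> nat -> nat)
    (bot top : nat) (le : nat -> nat -> Prop) : Prop :=
  ce_bounded_prelattice meet join bot top le /\
  effectively_inseparable (equiv_of le bot) (equiv_of le top).

Definition universal_preordering (R : nat -> nat -> Prop) : Prop :=
  ce_rel R /\
  forall S : nat -> nat -> Prop, preordering S -> ce_rel S ->
    exists f, computable f /\ forall x y, S x y <-> R (f x) (f y).

(* Main.v *)
Require Import Defs.
From Stdlib Require Import Arith Lia Bool Classical IndefiniteDescription.

(** Fix a c.e. preorder [R].  The reduction [embed] sends [n] to a lattice term
    over switches, that is, over elements of the lattice that a strategy may
    force below [bot] or above [top] at a stage of its choice.  Writing [f] for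
    [embed] and [z n i j] for the switches,
<<
      f n = JOIN_{i <= n} ( p_i /\ MEET_{j <= n} ( q_j \/ z n i j ) ),
>>
    where [p_i = f i] and [q_j = f j] for [i, j < n], and [p_n = top],
    [q_n = bot].  The strategy watches the enumeration of [R].  When [n R j] is
    enumerated with [j < n], it forces the open switches [z n i j] to [bot]; when
    [i R n] is enumerated with [i < n], it forces the open switches [z n i j] to
    [top].  If both happen then [i R j], and [f i <= f j] is already known, so
    that whichever happens first does no harm: this yields [f x <= f y] whenever
    [x R y] (lemma [embed_mono]).

    Conversely, suppose that [f x <= f y] is enumerated and that there is a
    finite set [U] which is upwards closed on [0 .. x + y] for the part of [R]
    enumerated so far, contains [x] and does not contain [y].  The strategy then
    settles all the open switches at once: [z n i j] is forced to [top] if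
    [j < n], or if [i = j = n] and [n] is in [U], and to [bot] otherwise.  By
    induction on [n <= x + y], [f n] is above [top] if [n] is in [U] and below
    [bot] otherwise, hence [top <= f x <= f y <= bot], which is impossible (lemma
    [no_violation]).  If [f x <= f y] holds without [x R y], the set of the [w]
    with [x R w], cut off at [x + y], is such a [U]; therefore [f x <= f y]
    implies [x R y] (lemma [embed_reflects]).

    The switches come from effective inseparability (lemma [ei_forcing]).  Let
    [A] and [B] be the classes of [bot] and [top], and [phi] a productive
    function for them.  By the recursion theorem a program may use its own index
    [e], hence two indices [u], [v] depending on [e] and [k], to enumerate
<<
      W_u = A + { phi(u,v), if the strategy decides top for k },
      W_v = B + { phi(u,v), if the strategy decides bot for k }.
>>
    The element [phi(u,v)] is the switch [k].  It is defined, since otherwise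
    [W_u = A] and [W_v = B] would be disjoint; and if the strategy decides, say,
    [top] for [k] while [phi(u,v)] is not in [B], then [W_u] and [W_v] are
    disjoint and [phi(u,v)] is in [W_u], against productivity.  The strategy
    itself consults the switches, and its code has to be fixed before [e] is
    known.  It is therefore computed relative to an oracle for the switches,
    uniformly in [e]; this is the notion [ocomp]. *)

(** * Computability relative to the switches *)

(** The functional [F g x] is computable from the oracle [g], where [g] is given
    by the code [G] with a parameter [e]: one code computes [F g] for every [e]
    such that [G] with parameter [e] computes the total function [g].  When [F]
    ignores [g], this is plain computability, for which [G := Zero] serves. *)
Definition ocomp (G : code) (F : (nat -> nat) -> nat -> nat) : Prop :=
  exists c, forall e g, (forall k, eval G (pr e k) (g k)) ->
    forall x, eval c (pr e x) (F g x).

(** Decidability relative to the oracle. *)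
Definition odec (G : code) (p : (nat -> nat) -> nat -> bool) : Prop :=
  ocomp G (fun g x => if p g x then 1 else 0).

Definition Id : code := Pair Fst Snd.

Fixpoint constc (n : nat) : code :=
  match n with 0 => Zero | S n => Comp Succ (constc n) end.

Lemma eval_Id (x : nat) : eval Id x x.
Proof. exists (pi1 x), (pi2 x). now rewrite pr_pi. Qed.

Lemma eval_constc (n x : nat) : eval (constc n) x n.
Proof. induction n as [ | n IH]; simpl; [reflexivity | now exists n]. Qed.

Lemma eval_Fst (x y : nat) : eval Fst (pr x y) x.
Proof. simpl. now rewrite pi1_pr. Qed.

Lemma eval_Snd (x y : nat) : eval Snd (pr x y) y.
Proof. simpl. now rewrite pi2_pr. Qed.

Lemma eval_Pair (f g : code) (x a b : nat) :
  eval f x a -> eval g x b -> eval (Pair f g) x (pr a b).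
Proof. intros; now exists a, b. Qed.

Lemma eval_Comp (f g : code) (x y z : nat) :
  eval g x y -> eval f y z -> eval (Comp f g) x z.
Proof. intros; now exists y. Qed.

#[local] Opaque pr pi1 pi2.

Create HintDb ev.
#[local] Hint Resolve eval_Id eval_constc eval_Fst eval_Snd eval_Pair eval_Comp : ev.

Section Closure.
Context (G : code).
Implicit Types F A B N : (nat -> nat) -> nat -> nat.

Lemma ocomp_ext F A : (forall g x, F g x = A g x) -> ocomp G A -> ocomp G F.
Proof.
  intros H [c Hc]. exists c. intros e g Hg x. rewrite H. auto.
Qed.

Lemma ocomp_const k : ocomp G (fun _ _ => k).
Proof. exists (constc k). intros. apply eval_constc. Qed.

Lemma ocomp_id : ocomp G (fun _ x => x).
Proof. exists Snd. intros. apply eval_Snd. Qed.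

Lemma ocomp_comp F A :
  ocomp G F -> ocomp G A -> ocomp G (fun g x => F g (A g x)).
Proof.
  intros [c Hc] [d Hd]. exists (Comp c (Pair Fst d)). intros. eauto with ev.
Qed.

Lemma ocomp_pr A B :
  ocomp G A -> ocomp G B -> ocomp G (fun g x => pr (A g x) (B g x)).
Proof. intros [c Hc] [d Hd]. exists (Pair c d). eauto with ev. Qed.

(** Functions of two arguments are computed on pairs.  This form, stated with
    the projections, turns the variables bound inside an expression into
    components of the input. *)
Lemma ocomp_comp2 (F : (nat -> nat) -> nat -> nat -> nat) A B :
  ocomp G (fun g z => F g (pi1 z) (pi2 z)) ->
  ocomp G A -> ocomp G B -> ocomp G (fun g x => F g (A g x) (B g x)).
Proof.
  intros HF HA HB.
  apply ocomp_ext with (2 := ocomp_comp _ _ HF (ocomp_pr _ _ HA HB)).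
  intros. now rewrite pi1_pr, pi2_pr.
Qed.

Lemma ocomp_code (c : code) (h : nat -> nat) A :
  (forall x, eval c x (h x)) -> ocomp G A -> ocomp G (fun g x => h (A g x)).
Proof. intros Hc [d Hd]. exists (Comp c d). eauto with ev. Qed.

Lemma ocomp_pi1 A : ocomp G A -> ocomp G (fun g x => pi1 (A g x)).
Proof. apply (ocomp_code Fst). reflexivity. Qed.

Lemma ocomp_pi2 A : ocomp G A -> ocomp G (fun g x => pi2 (A g x)).
Proof. apply (ocomp_code Snd). reflexivity. Qed.

Lemma ocomp_S A : ocomp G A -> ocomp G (fun g x => S (A g x)).
Proof. apply (ocomp_code Succ). reflexivity. Qed.

Lemma ocomp_oracle A : ocomp G A -> ocomp G (fun g x => g (A g x)).
Proof.
  intros [d Hd]. exists (Comp G (Pair Fst d)). intros. eauto with ev.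
Qed.

Lemma ocomp_op (op : nat -> nat -> nat) A B :
  computable2 op -> ocomp G A -> ocomp G B ->
  ocomp G (fun g x => op (A g x) (B g x)).
Proof.
  intros [c Hc]. apply (ocomp_comp2 (fun _ => op)).
  apply ocomp_ext with (A := fun _ z => op (pi1 z) (pi2 z)); [reflexivity | ].
  apply (ocomp_code c (fun z => op (pi1 z) (pi2 z)) (fun _ z => z)); [ | apply ocomp_id].
  intros x. rewrite <- (pr_pi x) at 1. now apply Hc.
Qed.

Lemma ocomp_rec (St : (nat -> nat) -> nat -> nat -> nat -> nat) B N :
  ocomp G B ->
  ocomp G (fun g z => St g (pi1 z) (pi1 (pi2 z)) (pi2 (pi2 z))) ->
  ocomp G N ->
  ocomp G (fun g x => nat_rect (fun _ => nat) (B g x)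
                        (fun i w => St g x i w) (N g x)).
Proof.
  intros [b Hb] [s Hs] [d Hd].
  exists (Comp
    (Prec b (Comp s (Pair (Comp Fst Fst) (Pair (Comp Snd Fst) Snd))))
    (Pair Id d)).
  intros e g Hg x. eapply eval_Comp; [eauto with ev | ].
  cbn [eval]. rewrite pi1_pr, pi2_pr.
  induction (N g x) as [ | n IH]; cbn [nat_rect]; [auto | ].
  eexists; split; [exact IH | ].
  set (w := nat_rect _ _ _ _).
  exists (pr e (pr x (pr n w))); split.
  - change (eval (Pair (Comp Fst Fst) (Pair (Comp Snd Fst) Snd))
      (pr (pr e x) (pr n w)) (pr e (pr x (pr n w)))). eauto 10 with ev.
  - specialize (Hs e g Hg (pr x (pr n w))).
    now rewrite !pi2_pr, !pi1_pr in Hs.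
Qed.

Lemma ocomp_if (p : (nat -> nat) -> nat -> bool) A B :
  odec G p -> ocomp G A -> ocomp G B ->
  ocomp G (fun g x => if p g x then A g x else B g x).
Proof.
  intros Hp HA HB.
  apply ocomp_ext with
    (A := fun g x => nat_rect (fun _ => nat) (B g x) (fun _ _ => A g x)
                       (if p g x then 1 else 0)).
  - intros. now destruct (p g x).
  - apply (ocomp_rec (fun g x _ _ => A g x)); auto.
    apply (ocomp_comp A); auto. apply ocomp_pi1, ocomp_id.
Qed.

End Closure.

Create HintDb ocomp.
#[local] Hint Constants Opaque : ocomp.
#[local] Hint Resolve ocomp_const ocomp_id | 0 : ocomp.
#[local] Hint Resolve ocomp_pr ocomp_pi1 ocomp_pi2 ocomp_S ocomp_oracle ocomp_rec
  ocomp_if | 1 : ocomp.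

Ltac ocomp_auto := solve [typeclasses eauto with nocore ocomp].

Section Decisions.
Context (G : code).
Implicit Types A B N : (nat -> nat) -> nat -> nat.
Implicit Types p q : (nat -> nat) -> nat -> bool.

Lemma ocomp_pred A : ocomp G A -> ocomp G (fun g x => pred (A g x)).
Proof.
  intros HA. apply ocomp_ext with
    (A := fun g x => nat_rect (fun _ => nat) 0 (fun i _ => i) (A g x)).
  - intros g x. now destruct (A g x).
  - ocomp_auto.
Qed.

Lemma ocomp_sub A B : ocomp G A -> ocomp G B -> ocomp G (fun g x => A g x - B g x).
Proof.
  intros HA HB. apply ocomp_ext with
    (A := fun g x => nat_rect (fun _ => nat) (A g x) (fun _ w => pred w) (B g x)).
  - intros g x. induction (B g x) as [ | n IH]; cbn [nat_rect]; lia.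
  - apply ocomp_rec; auto. apply ocomp_pred. ocomp_auto.
Qed.

Lemma ocomp_add A B : ocomp G A -> ocomp G B -> ocomp G (fun g x => A g x + B g x).
Proof.
  intros HA HB. apply ocomp_ext with
    (A := fun g x => nat_rect (fun _ => nat) (A g x) (fun _ w => S w) (B g x)).
  - intros g x. induction (B g x) as [ | n IH]; cbn [nat_rect]; lia.
  - ocomp_auto.
Qed.

Lemma odec_ext p q : (forall g x, p g x = q g x) -> odec G q -> odec G p.
Proof.
  intros H. apply ocomp_ext. intros g x. now rewrite H.
Qed.

Lemma odec_is0 A : ocomp G A -> odec G (fun g x => A g x =? 0).
Proof.
  intros HA. unfold odec. apply ocomp_ext with
    (A := fun g x => nat_rect (fun _ => nat) 1 (fun _ _ => 0) (A g x)).
  - intros g x. now destruct (A g x).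
  - ocomp_auto.
Qed.

Lemma odec_neg p : odec G p -> odec G (fun g x => negb (p g x)).
Proof.
  intros Hp. unfold odec. apply ocomp_ext with
    (A := fun g x => if p g x then 0 else 1).
  - intros g x. now destruct (p g x).
  - ocomp_auto.
Qed.

Lemma odec_and p q :
  odec G p -> odec G q -> odec G (fun g x => p g x && q g x).
Proof.
  intros Hp Hq. unfold odec. apply ocomp_ext with
    (A := fun g x => if p g x then (if q g x then 1 else 0) else 0).
  - intros g x. now destruct (p g x).
  - apply ocomp_if; auto. apply ocomp_const.
Qed.

Lemma odec_or p q :
  odec G p -> odec G q -> odec G (fun g x => p g x || q g x).
Proof.
  intros Hp Hq. unfold odec. apply ocomp_ext with
    (A := fun g x => if p g x then 1 else (if q g x then 1 else 0)).
  - intros g x. now destruct (p g x).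
  - apply ocomp_if; auto. apply ocomp_const.
Qed.

Lemma odec_leb A B : ocomp G A -> ocomp G B -> odec G (fun g x => A g x <=? B g x).
Proof.
  intros HA HB.
  apply odec_ext with (q := fun g x => A g x - B g x =? 0).
  - intros g x. destruct (Nat.leb_spec (A g x) (B g x));
      destruct (Nat.eqb_spec (A g x - B g x) 0); auto; lia.
  - apply odec_is0, ocomp_sub; auto.
Qed.

Lemma odec_ltb A B : ocomp G A -> ocomp G B -> odec G (fun g x => A g x <? B g x).
Proof. intros. apply odec_leb; auto. now apply ocomp_S. Qed.

Lemma odec_eqb A B : ocomp G A -> ocomp G B -> odec G (fun g x => A g x =? B g x).
Proof.
  intros HA HB.
  apply odec_ext with (q := fun g x => (A g x <=? B g x) && (B g x <=? A g x)).
  - intros g x. destruct (Nat.eqb_spec (A g x) (B g x)) as [-> | H].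
    + now rewrite Nat.leb_refl.
    + destruct (Nat.leb_spec (A g x) (B g x));
        destruct (Nat.leb_spec (B g x) (A g x)); auto; lia.
  - apply odec_and; apply odec_leb; auto.
Qed.

End Decisions.

#[local] Hint Resolve ocomp_pred ocomp_sub ocomp_add | 1 : ocomp.
#[local] Hint Resolve odec_is0 odec_neg odec_and odec_or odec_leb odec_ltb
  odec_eqb | 1 : ocomp.

(** * Bounded quantification and bounded search *)

Fixpoint allb (p : nat -> bool) (n : nat) : bool :=
  match n with 0 => true | S n => allb p n && p n end.

Lemma allb_true p n : allb p n = true <-> forall m, m < n -> p m = true.
Proof.
  induction n as [ | n IH]; simpl; [split; [lia | auto] | ].
  rewrite andb_true_iff, IH. split.
  - intros [H1 H2] m Hm. destruct (Nat.eq_dec m n) as [-> | ]; auto. apply H1. lia.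
  - auto.
Qed.

(** The least [m < n] with [p m = true], or [n] if there is none. *)
Definition least (p : nat -> bool) (n : nat) : nat :=
  nat_rect (fun _ => nat) 0
    (fun m w => if (w =? m) && negb (p m) then S m else w) n.

Lemma least_spec p n :
  least p n <= n /\ (forall m, m < least p n -> p m = false) /\
  (least p n < n -> p (least p n) = true).
Proof.
  induction n as [ | n (H1 & H2 & H3)]; [simpl; repeat split; lia | ].
  unfold least in *. cbn [nat_rect]. set (w := nat_rect _ _ _ _) in *.
  destruct (Nat.eqb_spec w n) as [E | E]; simpl.
  - rewrite E in *. destruct (p n) eqn:P; simpl; rewrite ?E.
    + repeat split; auto.
    + repeat split; [lia | | lia]. intros m Hm.
      destruct (Nat.eq_dec m n) as [-> | ]; auto. apply H2. lia.
  - repeat split; [lia | auto | ]. intros. apply H3. lia.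
Qed.

Lemma first_true (p : nat -> bool) t :
  p t = true -> exists t', t' <= t /\ p t' = true /\ forall m, m < t' -> p m = false.
Proof.
  intros Ht. destruct (least_spec p (S t)) as (H1 & H2 & H3).
  exists (least p (S t)).
  destruct (Nat.eq_dec (least p (S t)) (S t)) as [Q | Q].
  - rewrite H2 in Ht by lia. discriminate.
  - repeat split; [lia | apply H3; lia | auto].
Qed.

Lemma odec_allb (G : code) (p : (nat -> nat) -> nat -> nat -> bool) N :
  odec G (fun g z => p g (pi1 z) (pi2 z)) -> ocomp G N ->
  odec G (fun g x => allb (p g x) (N g x)).
Proof.
  intros Hp HN. unfold odec. apply ocomp_ext with
    (A := fun g x => nat_rect (fun _ => nat) 1
       (fun i w => if p g x i then w else 0) (N g x)).
  - intros g x. induction (N g x) as [ | n IH]; cbn [nat_rect allb]; auto.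
    rewrite <- IH. now destruct (p g x n), (allb (p g x) n).
  - pose proof (fun A B =>
    ocomp_comp2 G (fun g a b => if p g a b then 1 else 0) A B Hp) as H.
    apply ocomp_rec; [apply ocomp_const | | auto].
    apply ocomp_if; [apply H | | ]; ocomp_auto.
Qed.

Lemma ocomp_least (G : code) (p : (nat -> nat) -> nat -> nat -> bool) N :
  odec G (fun g z => p g (pi1 z) (pi2 z)) -> ocomp G N ->
  ocomp G (fun g x => least (p g x) (N g x)).
Proof.
  intros Hp HN. unfold least.
  pose proof (fun A B =>
    ocomp_comp2 G (fun g a b => if p g a b then 1 else 0) A B Hp) as H.
  apply ocomp_rec; [apply ocomp_const | | auto].
  apply ocomp_if; [apply odec_and; [ocomp_auto | apply odec_neg; apply H] | | ];
    ocomp_auto.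
Qed.

#[local] Hint Resolve odec_allb ocomp_least | 1 : ocomp.

(** * Evaluation in bounded time *)

(** Sequencing of partial results, where [0] stands for no result and [S y] for
    the result [y]. *)
Definition bind (n : nat) (k : nat -> nat) : nat :=
  nat_rect (fun _ => nat) 0 (fun a _ => k a) n.

(** The result of [c] on [x] at stage [s]: [0] if there is none yet, and [S y] if
    [c] is found to have value [y].  The stage bounds only the unbounded searches.
    For each [c], this is a total computable function of [s] and [x]. *)
Fixpoint run (c : code) (s x : nat) : nat :=
  match c with
  | Zero => 1
  | Succ => S (S x)
  | Fst => S (pi1 x)
  | Snd => S (pi2 x)
  | Pair f g => bind (run f s x) (fun a => bind (run g s x) (fun b => S (pr a b)))
  | Comp f g => bind (run g s x) (fun z => run f s z)
  | Prec f g =>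
      nat_rect (fun _ => nat) (run f s (pi1 x))
        (fun n h => bind h (fun w => run g s (pr (pi1 x) (pr n w)))) (pi2 x)
  | Mu f =>
      (* The least argument below [s] at which [f] has value [0] or no value yet, or
         [s] itself. *)
      let y := least (fun m => run f s (pr x m) <=? 1) s in
      if run f s (pr x y) =? 1 then S y else 0
  end.

Lemma bind_S n k y : bind n k = S y <-> exists a, n = S a /\ k a = S y.
Proof.
  destruct n as [ | a]; simpl; split; try discriminate.
  - now intros (a & H & _).
  - eauto.
  - now intros (b & [= ->] & H).
Qed.

Lemma run_sound c : forall s x y, run c s x = S y -> eval c x y.
Proof.
  induction c as [ | | | | f IHf g IHg | f IHf g IHg | f IHf g IHg | f IHf];
    simpl; intros s x y; try (intros [= <-]; reflexivity).
  - intros (a & Ha & (b & Hb & [= <-])%bind_S)%bind_S. exists a, b. eauto.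
  - intros (a & Ha & Hb)%bind_S. eauto.
  - revert y. induction (pi2 x) as [ | n IH]; simpl; intros y; [eauto | ].
    intros (w & Hw & H)%bind_S. eauto.
  - set (p := fun m => run f s (pr x m) <=? 1).
    destruct (least_spec p s) as (_ & H & _).
    destruct (Nat.eqb_spec (run f s (pr x (least p s))) 1) as [E | ]; [ | discriminate].
    intros [= <-]. split; [eauto | ].
    intros m Hm. apply H in Hm. unfold p in Hm. apply Nat.leb_gt in Hm.
    destruct (run f s (pr x m)) as [ | [ | k]] eqn:R; try lia. eauto.
Qed.

Lemma least_eq p n y :
  y < n -> p y = true -> (forall m, m < y -> p m = false) -> least p n = y.
Proof.
  intros Hy Hp H. destruct (least_spec p n) as (H1 & H2 & H3).
  destruct (Nat.lt_trichotomy (least p n) y) as [L | [L | L]]; auto.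
  - rewrite H in H3 by auto. assert (false = true) by (apply H3; lia). discriminate.
  - rewrite H2 in Hp by auto. discriminate.
Qed.

Lemma run_mono c : forall s s' x y, s <= s' -> run c s x = S y -> run c s' x = S y.
Proof.
  induction c as [ | | | | f IHf g IHg | f IHf g IHg | f IHf g IHg | f IHf];
    simpl; intros s s' x y Hs; auto.
  - intros (a & Ha & (b & Hb & [= <-])%bind_S)%bind_S.
    rewrite (IHf _ _ _ _ Hs Ha). simpl. now rewrite (IHg _ _ _ _ Hs Hb).
  - intros (a & Ha & Hb)%bind_S.
    rewrite (IHg _ _ _ _ Hs Ha). simpl. eauto.
  - revert y. induction (pi2 x) as [ | n IH]; simpl; intros y; [eauto | ].
    intros (w & Hw & H)%bind_S. rewrite (IH _ Hw). simpl. eauto.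
  - set (p := fun m => run f s (pr x m) <=? 1).
    set (p' := fun m => run f s' (pr x m) <=? 1).
    destruct (least_spec p s) as (L & H & _).
    destruct (Nat.eqb_spec (run f s (pr x (least p s))) 1) as [E | ]; [ | discriminate].
    intros [= Ey]. rewrite Ey in *.
    assert (H' : forall m, m < y -> p' m = false).
    { intros m Hm. apply H in Hm. unfold p, p' in *. apply Nat.leb_gt in Hm.
      apply Nat.leb_gt.
      destruct (run f s (pr x m)) as [ | k] eqn:R; [lia | ].
      now rewrite (IHf _ _ _ _ Hs R). }
    pose proof (IHf _ _ _ _ Hs E) as E'.
    assert (least p' s' = y) as ->.
    { destruct (least_spec p' s') as (L' & G' & K').
      destruct (Nat.lt_trichotomy (least p' s') y) as [Q | [Q | Q]]; auto.
      - rewrite H' in K' by auto. assert (false = true) by (apply K'; lia). discriminate.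
      - apply G' in Q. unfold p' in Q. now rewrite E' in Q. }
    now rewrite E'.
Qed.

Lemma run_complete c : forall x y, eval c x y -> exists s, run c s x = S y.
Proof.
  induction c as [ | | | | f IHf g IHg | f IHf g IHg | f IHf g IHg | f IHf];
    simpl; intros x y; try (intros ->; now exists 0).
  - intros (a & b & Ha & Hb & ->).
    destruct (IHf _ _ Ha) as [s Hs], (IHg _ _ Hb) as [t Ht]. exists (s + t).
    rewrite (run_mono f s (s + t) _ _ (Nat.le_add_r _ _) Hs). simpl.
    now rewrite (run_mono g t (s + t) _ _ (Nat.le_add_l _ _) Ht).
  - intros (a & Ha & Hb).
    destruct (IHg _ _ Ha) as [s Hs], (IHf _ _ Hb) as [t Ht]. exists (s + t).
    rewrite (run_mono g s (s + t) _ _ (Nat.le_add_r _ _) Hs). simpl.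
    now rewrite (run_mono f t (s + t) _ _ (Nat.le_add_l _ _) Ht).
  - revert y. induction (pi2 x) as [ | n IH]; simpl; intros y; [eauto | ].
    intros (w & Hw & H). destruct (IH _ Hw) as [s Hs], (IHg _ _ H) as [t Ht].
    exists (s + t).
    pose proof (run_mono (Prec f g) s (s + t) (pr (pi1 x) n) w) as M.
    simpl in M. rewrite pi1_pr, pi2_pr in M. rewrite (M (Nat.le_add_r _ _) Hs).
    simpl. now rewrite (run_mono g t (s + t) _ _ (Nat.le_add_l _ _) Ht).
  - intros [H0 H].
    assert (B : exists s, forall m, m < y -> exists k, run f s (pr x m) = S (S k)).
    { clear H0. induction y as [ | n IH]; [exists 0; lia | ].
      destruct IH as [s Hs]; [auto | ].
      destruct (H n) as [k Hk]; [lia | ]. destruct (IHf _ _ Hk) as [t Ht].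
      exists (s + t). intros m Hm. destruct (Nat.eq_dec m n) as [-> | ].
      - exists k. now apply (run_mono f t); [lia | ].
      - destruct (Hs m) as [j Hj]; [lia | ].
        exists j. now apply (run_mono f s); [lia | ]. }
    destruct B as [s Hs], (IHf _ _ H0) as [t Ht].
    exists (S (s + t + y)). set (u := S (s + t + y)).
    assert (E : run f u (pr x y) = 1) by (apply (run_mono f t); [lia | auto]).
    rewrite (least_eq _ u y).
    + now rewrite E.
    + lia.
    + now rewrite E.
    + intros m Hm. destruct (Hs m Hm) as [k Hk].
      now rewrite (run_mono f s u _ _ ltac:(lia) Hk).
Qed.

Lemma ocomp_bind (G : code) (k : (nat -> nat) -> nat -> nat -> nat) N :
  ocomp G (fun g z => k g (pi1 z) (pi2 z)) -> ocomp G N ->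
  ocomp G (fun g x => bind (N g x) (k g x)).
Proof.
  intros Hk HN. unfold bind. apply ocomp_rec; [apply ocomp_const | | auto].
  apply (ocomp_comp2 G k); ocomp_auto.
Qed.

Lemma ocomp_run (G c : code) A B :
  ocomp G A -> ocomp G B -> ocomp G (fun g x => run c (A g x) (B g x)).
Proof.
  apply (ocomp_comp2 G (fun _ => run c)).
  induction c as [ | | | | f IHf g IHg | f IHf g IHg | f IHf g IHg | f IHf];
    cbn [run]; try ocomp_auto.
  all: try pose proof (fun A B => ocomp_comp2 G (fun _ => run f) A B IHf) as Hf;
    clear IHf;
    try (pose proof (fun A B => ocomp_comp2 G (fun _ => run g) A B IHg) as Hg; clear IHg).
  - apply ocomp_bind; [ | apply Hf; ocomp_auto].
    apply ocomp_bind; [ocomp_auto | apply Hg; ocomp_auto].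
  - apply ocomp_bind; [apply Hf; ocomp_auto | apply Hg; ocomp_auto].
  - apply ocomp_rec; [ apply Hf; ocomp_auto | | ocomp_auto].
    apply ocomp_bind; [apply Hg; ocomp_auto | ocomp_auto].
  - assert (HL : ocomp G (fun _ x => least
      (fun m => run f (pi1 x) (pr (pi2 x) m) <=? 1) (pi1 x))).
    { apply ocomp_least; [apply odec_leb; [apply Hf | ] | ]; ocomp_auto. }
    apply ocomp_if; [apply odec_eqb; [apply Hf | ] | | ]; try ocomp_auto.
Qed.

#[local] Hint Resolve ocomp_run | 1 : ocomp.

(** * C.e. sets, parameters and the recursion theorem *)

Lemma ocomp_instance (G : code) F e g :
  ocomp G F -> (forall k, eval G (pr e k) (g k)) ->
  exists c, forall x, eval c x (F g x).
Proof.
  intros [c Hc] Hg. exists (Comp c (Pair (constc e) Id)). intros. eauto with ev.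
Qed.

(** A set is c.e. if it is the domain of a partial computable function. *)
Definition ce (P : nat -> Prop) : Prop :=
  exists c, forall x, P x <-> exists y, eval c x y.

Lemma ce_ext P Q : (forall x, P x <-> Q x) -> ce Q -> ce P.
Proof. intros H [c Hc]. exists c. intros. now rewrite H. Qed.

Lemma ce_W u : ce (W u).
Proof. now exists (decode u). Qed.

Lemma ce_preim P (h : nat -> nat) :
  ce P -> ocomp Zero (fun _ => h) -> ce (fun x => P (h x)).
Proof.
  intros [c Hc] Hh.
  destruct (ocomp_instance Zero _ 0 (fun _ => 0) Hh) as [d Hd];
    [reflexivity | ].
  exists (Comp c d). intros x. rewrite Hc. split.
  - intros [y Hy]. eauto with ev.
  - intros (y & z & Hz & Hy). rewrite (eval_functional _ _ _ _ Hz (Hd x)) in Hy.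
    eauto.
Qed.

Lemma ce_and P Q : ce P -> ce Q -> ce (fun x => P x /\ Q x).
Proof.
  intros [c Hc] [d Hd]. exists (Pair c d). intros x. rewrite Hc, Hd. split.
  - intros [[y Hy] [z Hz]]. eauto with ev.
  - intros (y & a & b & Ha & Hb & _). eauto.
Qed.

(** Projections of decidable relations are c.e. *)
Lemma ce_ex (p : nat -> nat -> bool) :
  odec Zero (fun _ z => p (pi1 z) (pi2 z)) ->
  ce (fun x => exists s, p x s = true).
Proof.
  intros Hp. unfold odec in Hp.
  assert (H : ocomp Zero (fun _ z => 1 - if p (pi1 z) (pi2 z) then 1 else 0))
    by ocomp_auto.
  destruct (ocomp_instance Zero _ 0 (fun _ => 0) H) as [c Hc]; [reflexivity | ].
  assert (E : forall x s, eval c (pr x s) (if p x s then 0 else 1)).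
  { intros x s. specialize (Hc (pr x s)). cbn beta in Hc.
    rewrite pi1_pr, pi2_pr in Hc. now destruct (p x s). }
  exists (Mu c). intros x. split.
  - intros [s Hs]. destruct (least_spec (p x) (S s)) as (L & B & A).
    assert (T : p x (least (p x) (S s)) = true).
    { destruct (Nat.eq_dec (least (p x) (S s)) (S s)) as [Q | Q]; [ | apply A; lia].
      rewrite B in Hs by lia. discriminate. }
    exists (least (p x) (S s)). split.
    + specialize (E x (least (p x) (S s))). now rewrite T in E.
    + intros m Hm. exists 0. specialize (E x m). now rewrite B in E.
  - intros (s & Hs & _). exists s. specialize (E x s).
    pose proof (eval_functional _ _ _ _ Hs E). now destruct (p x s).
Qed.

Lemma ce_or P Q : ce P -> ce Q -> ce (fun x => P x \/ Q x).
Proof.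
  intros [c Hc] [d Hd].
  apply ce_ext with
    (Q := fun x => exists s, (1 <=? run c s x) || (1 <=? run d s x) = true).
  - intros x. rewrite Hc, Hd. split.
    + intros [[y H] | [y H]]; destruct (run_complete _ _ _ H) as [s Hs];
        exists s; rewrite Hs; auto using orb_true_r.
    + intros [s [H | H]%orb_true_iff]; apply Nat.leb_le in H; [left | right].
      * destruct (run c s x) as [ | y] eqn:R; [lia | ]. exists y.
        eapply run_sound; eauto.
      * destruct (run d s x) as [ | y] eqn:R; [lia | ]. exists y.
        eapply run_sound; eauto.
  - apply (ce_ex (fun x s => (1 <=? run c s x) || (1 <=? run d s x))).
    ocomp_auto.
Qed.

Lemma ce_graph (c : code) (a b : nat -> nat) :
  ocomp Zero (fun _ => a) -> ocomp Zero (fun _ => b) ->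
  ce (fun x => eval c (a x) (b x)).
Proof.
  intros Ha Hb.
  apply ce_ext with (Q := fun x => exists s, run c s (a x) =? S (b x) = true).
  - intros x. split.
    + intros H. destruct (run_complete _ _ _ H) as [s Hs]. exists s.
      now apply Nat.eqb_eq.
    + intros [s Hs%Nat.eqb_eq]. eapply run_sound; eauto.
  - pose proof (fun A => ocomp_comp Zero (fun _ => a) A Ha) as Ha'.
    pose proof (fun A => ocomp_comp Zero (fun _ => b) A Hb) as Hb'.
    apply (ce_ex (fun x s => run c s (a x) =? S (b x))).
    apply odec_eqb; [apply ocomp_run; [ | apply Ha'] | apply ocomp_S, Hb']; ocomp_auto.
Qed.

(** A numerical form of [encode (constc n)], computable in [n]. *)
Definition const_index (n : nat) : nat :=
  nat_rect (fun _ => nat) (encode Zero)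
    (fun _ w => pr 5 (pr (encode Succ) w)) n.

(** The index [smn a n] runs the program [a] on inputs [pr n x]. *)
Definition smn (a n : nat) : nat :=
  pr 5 (pr a (pr 4 (pr (const_index n) (encode Id)))).

Lemma const_index_encode n : const_index n = encode (constc n).
Proof.
  induction n as [ | n IH]; [reflexivity | ].
  cbn [constc encode]. rewrite <- IH. reflexivity.
Qed.

Lemma W_smn a n x : W (smn a n) x <-> W a (pr n x).
Proof.
  unfold W, smn.
  assert (D : decode (pr 5 (pr a (pr 4 (pr (const_index n) (encode Id))))) =
              Comp (decode a) (Pair (constc n) Id)).
  { rewrite decode_unfold. cbv zeta. rewrite !pi1_pr, !pi2_pr, !pi1_pr.
    f_equal. rewrite const_index_encode.
    change (decode (encode (Pair (constc n) Id)) = Pair (constc n) Id).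
    apply decode_encode. }
  rewrite D. split.
  - intros (y & z & (p & q & Hp & Hq & ->) & H).
    rewrite (eval_functional _ _ _ _ Hp (eval_constc n x)),
      (eval_functional _ _ _ _ Hq (eval_Id x)) in H. eauto.
  - intros [y Hy]. eauto with ev.
Qed.

Lemma ocomp_smn G A B :
  ocomp G A -> ocomp G B -> ocomp G (fun g x => smn (A g x) (B g x)).
Proof. intros HA HB. unfold smn, const_index. ocomp_auto. Qed.

#[local] Hint Resolve ocomp_smn | 1 : ocomp.

(** A c.e. set may be enumerated by a program that refers to its own index:
    [e] is [smn q q], where [q] is an index of the set of the [pr a x] with
    [P (pr (smn a a) x)]. *)
Lemma recursion_theorem P :
  ce P -> exists e, forall x, W e x <-> P (pr e x).
Proof.
  intros HP.
  assert (HQ : ce (fun z => P (pr (smn (pi1 z) (pi1 z)) (pi2 z)))).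
  { apply (ce_preim P (fun z => pr (smn (pi1 z) (pi1 z)) (pi2 z))); auto. ocomp_auto. }
  destruct HQ as [c Hc].
  exists (smn (encode c) (encode c)). intros x.
  rewrite W_smn. unfold W at 1. rewrite decode_encode, <- Hc, pi1_pr, pi2_pr.
  reflexivity.
Qed.

(** * Forcing elements into an effectively inseparable pair *)

(** The code [G], with a suitable parameter [e], produces for each [k] an element
    that the strategy [D], run with the same [e], can place in [A] by the output
    [0] on [k] and in [B] by the output [1].  As [G] does not depend on [D], the
    strategy may call [G]. *)
Lemma ei_forcing A B :
  ce A -> ce B -> effectively_inseparable A B ->
  exists G, forall D, exists e, forall k, exists z,
    eval G (pr e k) z /\
    (eval D (pr e k) 0 -> A z) /\ (eval D (pr e k) 1 -> B z).
Proof.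
  intros HA HB [disj (phi & [cphi Hphi] & prod)].
  assert (Hidx : ocomp Zero
    (fun _ z => pr (smn (pi1 z) (pr 0 (pi2 z))) (smn (pi1 z) (pr 1 (pi2 z)))))
    by ocomp_auto.
  destruct (ocomp_instance Zero _ 0 (fun _ => 0) Hidx) as [cidx Hcidx];
    [reflexivity | ].
  set (G := Comp cphi cidx).
  assert (HG : forall e k z, eval G (pr e k) z <->
    phi (smn e (pr 0 k)) (smn e (pr 1 k)) z).
  { intros e k z. rewrite Hphi. specialize (Hcidx (pr e k)). cbn beta in Hcidx.
    rewrite pi1_pr, pi2_pr in Hcidx. split.
    - intros (w & Hw & H). now rewrite (eval_functional _ _ _ _ Hw Hcidx) in H.
    - intros H. exact (eval_Comp _ _ _ _ _ Hcidx H). }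
  exists G. intros D.
  (* The input [m] stands for [pr e (pr (pr i k) x)], where [i = 0] asks about
     the set indexed by [u] and [i = 1] about the set indexed by [v].  The graphs
     of [Zero] and [Succ] express [i = 0] and [i = 1]. *)
  set (i := fun m => pi1 (pi1 (pi2 m))).
  set (ek := fun m => pr (pi1 m) (pi2 (pi1 (pi2 m)))).
  set (y := fun m => pi2 (pi2 m)).
  set (P := fun m =>
    (eval Zero (i m) (i m) /\ A (y m) \/ eval Succ 0 (i m) /\ B (y m)) \/
    (eval D (ek m) (1 - i m) /\ eval G (ek m) (y m))).
  assert (HP : ce P).
  { subst P i ek y. cbn beta.
    apply ce_or; [apply ce_or | ]; apply ce_and; try (apply ce_graph; ocomp_auto);
      [apply (ce_preim A) | apply (ce_preim B)]; auto; ocomp_auto. }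
  destruct (recursion_theorem P HP) as [e He].
  assert (Hu : forall k x, W (smn e (pr 0 k)) x <->
    A x \/ eval D (pr e k) 1 /\ eval G (pr e k) x).
  { intros k x. rewrite W_smn, He. subst P i ek y. cbn beta.
    repeat (rewrite pi1_pr || rewrite pi2_pr). cbn [eval Nat.sub].
    intuition discriminate. }
  assert (Hv : forall k x, W (smn e (pr 1 k)) x <->
    B x \/ eval D (pr e k) 0 /\ eval G (pr e k) x).
  { intros k x. rewrite W_smn, He. subst P i ek y. cbn beta.
    repeat (rewrite pi1_pr || rewrite pi2_pr). cbn [eval Nat.sub].
    intuition discriminate. }
  exists e. intros k.
  specialize (Hu k). specialize (Hv k). specialize (HG e k).
  set (u := smn e (pr 0 k)) in *. set (v := smn e (pr 1 k)) in *.
  (* If [G] diverges at [k], then [W u] and [W v] are just [A] and [B]. *)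
  assert (Hz : exists z, eval G (pr e k) z).
  { apply NNPP. intros N.
    destruct (prod u v) as (z & Hz & _).
    - intros x Hx. apply Hu. auto.
    - intros x Hx. apply Hv. auto.
    - intros x. rewrite Hu, Hv.
      intros [[Ha | [_ Ha]] [Hb | [_ Hb]]]; eauto. now apply (disj x).
    - apply N. exists z. now apply HG. }
  destruct Hz as [z Hz]. exists z. split; [auto | ].
  assert (U : forall x, eval G (pr e k) x -> x = z)
    by (intros x Hx; exact (eval_functional _ _ _ _ Hx Hz)).
  (* If [z] misses the target, adding it to the other set keeps the two sets
     disjoint, although [z] is the value of the productive function. *)
  split; intros Hd; apply NNPP; intros N.
  - assert (ND : ~ eval D (pr e k) 1)
      by (intros Hd'; discriminate (eval_functional _ _ _ _ Hd Hd')).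
    destruct (prod u v) as (w & Hw & Nw).
    + intros x Hx. apply Hu. auto.
    + intros x Hx. apply Hv. auto.
    + intros x. rewrite Hu, Hv.
      intros [[Ha | [? _]] [Hb | [_ Hb]]]; try tauto.
      * now apply (disj x).
      * apply U in Hb as ->. tauto.
    + apply Nw. right. apply Hv. apply HG in Hw. auto.
  - assert (ND : ~ eval D (pr e k) 0)
      by (intros Hd'; discriminate (eval_functional _ _ _ _ Hd Hd')).
    destruct (prod u v) as (w & Hw & Nw).
    + intros x Hx. apply Hu. auto.
    + intros x Hx. apply Hv. auto.
    + intros x. rewrite Hu, Hv.
      intros [[Ha | [_ Ha]] [Hb | [? _]]]; try tauto.
      * now apply (disj x).
      * apply U in Ha as ->. tauto.
    + apply Nw. left. apply Hu. apply HG in Hw. auto.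
Qed.

(** * Stages, unbounded search and finite sets *)

(** The relation [st s] is the part of [R] enumerated by stage [s]. *)
Lemma ce_rel_stages (R : nat -> nat -> Prop) :
  ce_rel R -> exists st : nat -> nat -> nat -> bool,
    (forall x y, R x y <-> exists s, st s x y = true) /\
    (forall s t x y, s <= t -> st s x y = true -> st t x y = true) /\
    (forall G A B C, ocomp G A -> ocomp G B -> ocomp G C ->
       odec G (fun g x => st (A g x) (B g x) (C g x))).
Proof.
  intros [u Hu]. exists (fun s x y => 1 <=? run (decode u) s (pr x y)). split; [ | split].
  - intros x y. rewrite Hu. split.
    + intros [z Hz]. destruct (run_complete _ _ _ Hz) as [s Hs]. exists s.
      now rewrite Hs.
    + intros [s Hs%Nat.leb_le].
      destruct (run (decode u) s (pr x y)) as [ | z] eqn:E; [lia | ].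
      exists z. eapply run_sound; eauto.
  - intros s t x y Hst Hs%Nat.leb_le.
    destruct (run (decode u) s (pr x y)) as [ | z] eqn:E; [lia | ].
    now rewrite (run_mono _ _ _ _ _ Hst E).
  - intros. ocomp_auto.
Qed.

(** The strategy that waits for the first stage [t] at which [F g k t] is not [0]
    and then returns its predecessor; it diverges if there is no such stage. *)
Lemma ocomp_search (G : code) (F : (nat -> nat) -> nat -> nat -> nat) :
  ocomp G (fun g z => F g (pi1 z) (pi2 z)) ->
  exists D, forall e g, (forall k, eval G (pr e k) (g k)) ->
    forall k t v, F g k t = S v -> (forall m, m < t -> F g k m = 0) ->
    eval D (pr e k) v.
Proof.
  intros HF.
  destruct (ocomp_pred G _ HF) as [p Hp].
  assert (HN : ocomp G (fun g z => 1 - F g (pi1 z) (pi2 z))).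
  { apply ocomp_sub; [apply ocomp_const | exact HF]. }
  destruct HN as [c Hc].
  exists (Comp p (Pair Fst (Pair Snd
    (Mu (Comp c (Pair (Comp Fst Fst) (Pair (Comp Snd Fst) Snd))))))).
  intros e g Hg k t v Hv Ht.
  assert (E : forall m, eval
    (Comp c (Pair (Comp Fst Fst) (Pair (Comp Snd Fst) Snd)))
    (pr (pr e k) m) (1 - F g k m)).
  { intros m. specialize (Hc e g Hg (pr k m)). cbn beta in Hc.
    rewrite pi1_pr, pi2_pr in Hc. eauto 10 with ev. }
  apply eval_Comp with (y := pr e (pr k t)).
  - apply eval_Pair; [apply eval_Fst | apply eval_Pair; [apply eval_Snd | ]].
    split.
    + specialize (E t). now rewrite Hv in E.
    + intros m Hm. exists 0. specialize (E m). now rewrite Ht in E.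
  - specialize (Hp e g Hg (pr k t)). cbn beta in Hp.
    now rewrite pi1_pr, pi2_pr, Hv in Hp.
Qed.

(** The entry of rank [i] in the sequence coded by nested pairs, head first. *)
Definition seq_nth (w i : nat) : nat :=
  pi1 (nat_rect (fun _ => nat) w (fun _ v => pi2 v) i).

Lemma seq_nth_0 a w : seq_nth (pr a w) 0 = a.
Proof. apply pi1_pr. Qed.

Lemma seq_nth_S a w i : seq_nth (pr a w) (S i) = seq_nth w i.
Proof.
  unfold seq_nth. f_equal. induction i as [ | i IH]; cbn [nat_rect] in *.
  - apply pi2_pr.
  - now rewrite IH.
Qed.

Lemma ocomp_seq_nth G A B :
  ocomp G A -> ocomp G B -> ocomp G (fun g x => seq_nth (A g x) (B g x)).
Proof. intros. unfold seq_nth. ocomp_auto. Qed.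

#[local] Hint Resolve ocomp_seq_nth | 1 : ocomp.

(** Membership in the finite set coded by [w]: the entry of rank [i] is not [0]. *)
Definition mem (w i : nat) : bool := negb (seq_nth w i =? 0).

Lemma odec_mem G A B :
  ocomp G A -> ocomp G B -> odec G (fun g x => mem (A g x) (B g x)).
Proof. intros. unfold mem. ocomp_auto. Qed.

#[local] Hint Resolve odec_mem | 1 : ocomp.

Lemma mem_code n : forall P : nat -> Prop,
  exists w, forall i, i < n -> (mem w i = true <-> P i).
Proof.
  unfold mem.
  induction n as [ | n IH]; intros P; [exists 0; lia | ].
  destruct (IH (fun i => P (S i))) as [w Hw].
  destruct (classic (P 0)) as [H | H]; [exists (pr 1 w) | exists (pr 0 w)];
    (intros [ | i] Hi; [rewrite seq_nth_0 | rewrite seq_nth_S; apply Hw; lia]);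
    simpl; intuition discriminate.
Qed.

(** * Lattice terms over the switches *)

Section Lattice.
Context (meet join : nat -> nat -> nat) (bot top : nat) (le : nat -> nat -> Prop).
Context (L : ce_bounded_prelattice meet join bot top le).

Let PL := bounded_prelattice _ _ _ _ _ L.

Lemma le_refl x : le x x.
Proof. apply (preord_refl _ (le_preordering _ _ _ PL)). Qed.

Lemma le_trans x y z : le x y -> le y z -> le x z.
Proof. apply (preord_trans _ (le_preordering _ _ _ PL)). Qed.

Lemma le_join_l x y z : le x y -> le x (join y z).
Proof. intros. eapply le_trans; [eauto | apply (join_upper_l _ _ _ PL)]. Qed.

Lemma le_join_r x y z : le x z -> le x (join y z).
Proof. intros. eapply le_trans; [eauto | apply (join_upper_r _ _ _ PL)]. Qed.

Lemma meet_le_l x y z : le x z -> le (meet x y) z.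
Proof. intros. eapply le_trans; [apply (meet_lower_l _ _ _ PL) | eauto]. Qed.

Lemma meet_le_r x y z : le y z -> le (meet x y) z.
Proof. intros. eapply le_trans; [apply (meet_lower_r _ _ _ PL) | eauto]. Qed.

(** The join, and below the meet, of [F i] for [i < n]. *)
Definition bigjoin (F : nat -> nat) (n : nat) : nat :=
  nat_rect (fun _ => nat) bot (fun i w => join w (F i)) n.

Definition bigmeet (F : nat -> nat) (n : nat) : nat :=
  nat_rect (fun _ => nat) top (fun i w => meet w (F i)) n.

Lemma le_bigjoin F n i x : i < n -> le x (F i) -> le x (bigjoin F n).
Proof.
  unfold bigjoin. induction n as [ | n IH]; [lia | ]. cbn [nat_rect]. intros Hi Hx.
  destruct (Nat.eq_dec i n) as [-> | Hn].
  - now apply le_join_r.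
  - apply le_join_l, IH; auto. lia.
Qed.

Lemma bigjoin_le F n x : (forall i, i < n -> le (F i) x) -> le (bigjoin F n) x.
Proof.
  unfold bigjoin. induction n as [ | n IH]; cbn [nat_rect]; intros H.
  - apply (bot_least _ _ _ _ _ L).
  - apply (join_least _ _ _ PL); auto.
Qed.

Lemma bigmeet_le F n i x : i < n -> le (F i) x -> le (bigmeet F n) x.
Proof.
  unfold bigmeet. induction n as [ | n IH]; [lia | ]. cbn [nat_rect]. intros Hi Hx.
  destruct (Nat.eq_dec i n) as [-> | Hn].
  - now apply meet_le_r.
  - apply meet_le_l, IH; auto. lia.
Qed.

Lemma le_bigmeet F n x : (forall i, i < n -> le x (F i)) -> le x (bigmeet F n).
Proof.
  unfold bigmeet. induction n as [ | n IH]; cbn [nat_rect]; intros H.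
  - apply (top_greatest _ _ _ _ _ L).
  - apply (meet_greatest _ _ _ PL); auto.
Qed.

Lemma bigjoin_ext F F' n :
  (forall i, i < n -> F i = F' i) -> bigjoin F n = bigjoin F' n.
Proof.
  unfold bigjoin. induction n as [ | n IH]; cbn [nat_rect]; intros H; [auto | ].
  rewrite IH, H; auto.
Qed.

Lemma bigmeet_ext F F' n :
  (forall i, i < n -> F i = F' i) -> bigmeet F n = bigmeet F' n.
Proof.
  unfold bigmeet. induction n as [ | n IH]; cbn [nat_rect]; intros H; [auto | ].
  rewrite IH, H; auto.
Qed.

(** The value [h m] if [m < n], and the default [d] otherwise. *)
Definition below (h : nat -> nat) (n m d : nat) : nat :=
  if m <? n then h m else d.

(** The component [i] of the image of [n], given the images [h] of the smaller
    numbers.  The switch with indices [n], [i], [j] is [g (pr n (pr i j))]. *)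
Definition term (g h : nat -> nat) (n i : nat) : nat :=
  meet (below h n i top)
    (bigmeet (fun j => join (below h n j bot) (g (pr n (pr i j)))) (S n)).

Definition node (g h : nat -> nat) (n : nat) : nat :=
  bigjoin (term g h n) (S n).

(** The images of the numbers below [n] as a coded sequence, the last one first. *)
Definition hist (g : nat -> nat) (n : nat) : nat :=
  nat_rect (fun _ => nat) 0
    (fun n w => pr (node g (fun m => seq_nth w (n - S m)) n) w) n.

(** The reduction, defined by course-of-values recursion through [hist]. *)
Definition embed (g : nat -> nat) (n : nat) : nat := seq_nth (hist g (S n)) 0.

Lemma seq_nth_hist g n m : m < n -> seq_nth (hist g n) (n - S m) = embed g m.
Proof.
  induction n as [ | n IH]; [lia | ]. intros Hm.
  destruct (Nat.eq_dec m n) as [-> | Hn].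
  - now rewrite Nat.sub_diag.
  - replace (S n - S m) with (S (n - S m)) by lia.
    unfold hist at 1. cbn [nat_rect]. rewrite seq_nth_S. apply IH. lia.
Qed.

Lemma embed_eq g n : embed g n = node g (embed g) n.
Proof.
  unfold embed at 1, hist. cbn [nat_rect]. rewrite seq_nth_0.
  fold (hist g n). unfold node, term, below.
  assert (H : forall m d, (if m <? n then seq_nth (hist g n) (n - S m) else d) =
                          (if m <? n then embed g m else d)).
  { intros m d. destruct (Nat.ltb_spec m n); auto using seq_nth_hist. }
  apply bigjoin_ext. intros i _. rewrite H. f_equal.
  apply bigmeet_ext. intros j _. now rewrite H.
Qed.

Lemma ocomp_embed G A : ocomp G A -> ocomp G (fun g x => embed g (A g x)).
Proof.
  apply (ocomp_comp G (fun g x => embed g x)).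
  pose proof (fun A B => ocomp_op G join A B (join_computable _ _ _ PL)) as Hj.
  pose proof (fun A B => ocomp_op G meet A B (meet_computable _ _ _ PL)) as Hm.
  unfold embed, hist, node, term, below, bigjoin, bigmeet. ocomp_auto.
Qed.

#[local] Hint Resolve ocomp_embed | 1 : ocomp.

(** * The strategy for the switches *)

Section Strategy.
(** Stagewise enumerations of the lattice preorder and of the preorder to reduce. *)
Context (le_st R_st : nat -> nat -> nat -> bool).

(** By stage [t] the relation asks that the switches with indices [n], [i], [j] be
    sent to [bot], because the image of [n] is to lie below that of [j < n]; or, in
    the case of [high], to [top], because the image of [i < n] is to lie below that
    of [n]. *)
Definition low (t n j : nat) : bool := (j <? n) && R_st t n j.
Definition high (t n i : nat) : bool := (i <? n) && R_st t i n.

(** The stage [t = pr (pr x y) (pr w s)] codes a violation: [h x] is seen below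
    [h y] by stage [s], whereas the finite set [w] contains [x], does not contain
    [y], and is upwards closed on [0 .. x + y] for the relation known at stage
    [t].  Nothing is lost in using [t] itself as a stage of the relation. *)
Definition violation (h : nat -> nat) (t : nat) : bool :=
  let x := pi1 (pi1 t) in
  let y := pi2 (pi1 t) in
  let w := pi1 (pi2 t) in
  le_st (pi2 (pi2 t)) (h x) (h y) && mem w x && negb (mem w y) &&
  allb (fun p => allb (fun q => negb (mem w p && R_st t p q) || mem w q)
                   (S (x + y))) (S (x + y)).

(** The decision at stage [t] on the switch with indices [n], [i], [j]: [0] for
    none, [1] for [bot] and [2] for [top].  Only the first decision on a switch
    is carried out. *)
Definition verdict (h : nat -> nat) (t n i j : nat) : nat :=
  if low t n j then 1
  else if high t n i then 2
  else if violation h t then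
    (if (j <? n) || (i =? n) && mem (pi1 (pi2 t)) n then 2 else 1)
  else 0.

Lemma violation_spec h t :
  violation h t = true <->
  let x := pi1 (pi1 t) in
  let y := pi2 (pi1 t) in
  let w := pi1 (pi2 t) in
  le_st (pi2 (pi2 t)) (h x) (h y) = true /\ mem w x = true /\ mem w y = false /\
  (forall p q, p <= x + y -> q <= x + y ->
     mem w p = true -> R_st t p q = true -> mem w q = true).
Proof.
  unfold violation. cbv zeta. rewrite !andb_true_iff, negb_true_iff, allb_true.
  assert (E : forall P Q R S T, (S <-> T) -> (((P /\ Q) /\ R) /\ S <-> P /\ Q /\ R /\ T))
    by tauto.
  apply E. clear E. split.
  - intros H p q Hp Hq Mp Rpq. specialize (H p). rewrite allb_true in H.
    specialize (H ltac:(lia) q ltac:(lia)). now rewrite Mp, Rpq in H.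
  - intros H p Hp. apply allb_true. intros q Hq.
    specialize (H p q ltac:(lia) ltac:(lia)).
    destruct (mem _ p), (R_st t p q); auto; now rewrite H.
Qed.

Section Play.
Context (R : nat -> nat -> Prop) (g : nat -> nat).
Context (R_preord : preordering R).
Context (bot_top : ~ le top bot).
Context (le_st_spec : forall x y, le x y <-> exists s, le_st s x y = true).
Context (R_st_spec : forall x y, R x y <-> exists s, R_st s x y = true).
Context (R_st_mono : forall s t x y, s <= t -> R_st s x y = true -> R_st t x y = true).

Let f := embed g.
Let switch n i j := g (pr n (pr i j)).

(** The first decision on each switch is carried out. *)
Context (forcing : forall n i j t v, verdict f t n i j = S v ->
  (forall m, m < t -> verdict f m n i j = 0) ->
  (v = 0 -> le (switch n i j) bot) /\ (v = 1 -> le top (switch n i j))).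

(** How a switch is settled, once there is a decision on it at some stage. *)
Lemma settled n i j t :
  verdict f t n i j <> 0 ->
  exists t', t' <= t /\
    ((low t' n j = true /\ le (switch n i j) bot) \/
     (low t' n j = false /\ high t' n i = true /\ le top (switch n i j)) \/
     (low t' n j = false /\ high t' n i = false /\ violation f t' = true /\
      if (j <? n) || (i =? n) && mem (pi1 (pi2 t')) n
      then le top (switch n i j) else le (switch n i j) bot)).
Proof.
  intros Ht.
  destruct (first_true (fun t => negb (verdict f t n i j =? 0)) t) as
    (t' & Hle & H & Hm).
  - now destruct (verdict f t n i j).
  - exists t'. split; [auto | ].
    assert (Hm' : forall m, m < t' -> verdict f m n i j = 0).
    { intros m Hlt. specialize (Hm m Hlt). cbn beta in Hm.
      now destruct (verdict f m n i j). }
    pose proof (fun v Hv => forcing n i j t' v Hv Hm') as C.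
    revert C H. cbn beta. unfold verdict.
    destruct (low t' n j); [ | destruct (high t' n i); [ | destruct (violation f t')]];
      [ | | destruct (_ || _) | discriminate]; intros C _;
      destruct (C _ eq_refl) as [C0 C1]; auto 10.
Qed.

Lemma no_violation t : violation f t = false.
Proof.
  destruct (violation f t) eqn:V; [exfalso | auto].
  destruct (first_true (violation f) t V) as (t0 & _ & V0 & First). clear t V.
  pose proof V0 as V. apply violation_spec in V. cbv zeta in V.
  set (x := pi1 (pi1 t0)) in *. set (y := pi2 (pi1 t0)) in *.
  set (w := pi1 (pi2 t0)) in *. destruct V as (Hle & Hx & Hy & Hup).
  assert (D : forall n i j, verdict f t0 n i j <> 0).
  { intros n i j. unfold verdict. rewrite V0.
    destruct (low t0 n j), (high t0 n i); try discriminate.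
    now destruct (_ || _). }
  assert (T0 : forall t', t' <= t0 -> violation f t' = true -> t' = t0).
  { intros t' Ht' Hv. destruct (Nat.eq_dec t' t0); auto.
    rewrite First in Hv by lia. discriminate. }
  (* All switches are settled by stage [t0], either according to the part of the
     relation known at [t0], for which [w] is closed, or by the violation. *)
  assert (V : forall n, n <= x + y ->
    (mem w n = true -> le top (f n)) /\ (mem w n = false -> le (f n) bot)).
  { intros n. induction n as [n IH] using lt_wf_ind. intros Hn.
    unfold f. rewrite embed_eq by exact L. fold f. split; intros Hw.
    - apply le_bigjoin with (i := n); [lia | ].
      unfold term, below. rewrite Nat.ltb_irrefl.
      apply (meet_greatest _ _ _ PL); [apply le_refl | ].
      apply le_bigmeet. intros j Hj.
      destruct (settled n n j t0 (D _ _ _)) as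
        (t' & Ht' & [[Lo _] | [(_ & Hi & _) | (Lo & _ & Vi & H)]]).
      + apply andb_true_iff in Lo as [Hjn Hr]. rewrite Hjn.
        apply Nat.ltb_lt in Hjn. apply le_join_l, IH; [auto | lia | ].
        apply (Hup n j); auto; [lia | ]. now apply (R_st_mono t').
      + unfold high in Hi. rewrite Nat.ltb_irrefl in Hi. discriminate.
      + apply T0 in Vi; [subst t' | auto].
        fold w in H. rewrite Nat.eqb_refl, Hw, orb_true_r in H.
        now apply le_join_r.
    - apply bigjoin_le. intros i Hi. unfold term.
      assert (Fi : i < n -> mem w i = false -> le (below f n i top) bot).
      { intros Hin Hm. unfold below. destruct (Nat.ltb_spec i n); [ | lia].
        apply IH; auto. lia. }
      destruct (settled n i n t0 (D _ _ _)) as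
        (t' & Ht' & [[Lo _] | [(_ & Hh & _) | (Lo & _ & Vi & H)]]).
      + unfold low in Lo. rewrite Nat.ltb_irrefl in Lo. discriminate.
      + apply andb_true_iff in Hh as [Hin Hr]. apply Nat.ltb_lt in Hin.
        apply meet_le_l, Fi; auto.
        destruct (mem w i) eqn:Hm; auto.
        rewrite (Hup i n) in Hw; auto; [lia | ]. now apply (R_st_mono t').
      + apply T0 in Vi; [subst t' | auto].
        fold w in H. rewrite Nat.ltb_irrefl, Hw, andb_false_r in H.
        apply meet_le_r, bigmeet_le with (i := n); [lia | ].
        apply (join_least _ _ _ PL); [ | exact H].
        unfold below. rewrite Nat.ltb_irrefl. apply le_refl. }
  apply bot_top.
  apply le_trans with (f x); [apply V; auto; lia | ].
  apply le_trans with (f y); [ | apply V; auto; lia].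
  apply le_st_spec. eauto.
Qed.

(** Without violations, a switch that is requested to be low or high is settled
    by one of these requests, though not necessarily by the given one. *)
Lemma settled_true n i j :
  (j < n /\ R n j) \/ (i < n /\ R i n) ->
  (j < n /\ R n j /\ le (switch n i j) bot) \/
  (i < n /\ R i n /\ le top (switch n i j)).
Proof.
  intros H.
  assert (Ht : exists t, verdict f t n i j <> 0).
  { destruct H as [[Hl Hs] | [Hl Hs]]; apply R_st_spec in Hs as [t Ht]; exists t;
      unfold verdict, low, high; apply Nat.ltb_lt in Hl; rewrite Hl, Ht; simpl.
    - discriminate.
    - now destruct (_ && _). }
  destruct Ht as [t Ht].
  destruct (settled n i j t Ht) as
    (t' & _ & [[Lo Hz] | [(_ & Hi & Hz) | (_ & _ & V & _)]]).
  - apply andb_true_iff in Lo as [Hj%Nat.ltb_lt Hr]. left. rewrite R_st_spec. eauto.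
  - apply andb_true_iff in Hi as [Hj%Nat.ltb_lt Hr]. right. rewrite R_st_spec. eauto.
  - rewrite no_violation in V. discriminate.
Qed.

Lemma embed_mono n : forall x y, x <= n -> y <= n -> R x y -> le (f x) (f y).
Proof.
  pose proof (preord_trans _ R_preord) as R_trans.
  induction n as [n IH] using lt_wf_ind. intros x y Hx Hy Hxy.
  assert (IH' : forall x y, x < n -> y < n -> R x y -> le (f x) (f y)).
  { intros a b Ha Hb. apply (IH (max a b)); lia. }
  clear IH.
  destruct (Nat.eq_dec x n) as [Ex | Ex], (Nat.eq_dec y n) as [Ey | Ey].
  - subst. apply le_refl.
  (* [n R y]: bound each component [i], using [R i y] if the switch went high. *)
  - subst x. unfold f at 1. rewrite embed_eq by exact L. fold f.
    assert (Hyn : y < n) by lia.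
    apply bigjoin_le. intros i Hi. unfold term.
    destruct (settled_true n i y) as [(_ & _ & Hz) | (Hin & Hs & _)]; [auto | | ].
    + apply meet_le_r, bigmeet_le with (i := y); [lia | ].
      apply (join_least _ _ _ PL).
      * unfold below. apply Nat.ltb_lt in Hyn. rewrite Hyn. apply le_refl.
      * eapply le_trans; [exact Hz | apply (bot_least _ _ _ _ _ L)].
    + apply meet_le_l. unfold below. pose proof Hin as Hin'.
      apply Nat.ltb_lt in Hin'. rewrite Hin'. eauto.
  (* [x R n]: the component [x], using [R x j] for the switches that went low. *)
  - subst y. unfold f at 2. rewrite embed_eq by exact L. fold f.
    assert (Hxn : x < n) by lia.
    apply le_bigjoin with (i := x); [lia | ]. unfold term.
    apply (meet_greatest _ _ _ PL).
    + unfold below. apply Nat.ltb_lt in Hxn. rewrite Hxn. apply le_refl.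
    + apply le_bigmeet. intros j Hj.
      destruct (settled_true n x j) as [(Hjn & Hs & _) | (_ & _ & Hz)]; [auto | | ].
      * apply le_join_l. unfold below. pose proof Hjn as Hjn'.
        apply Nat.ltb_lt in Hjn'. rewrite Hjn'. eauto.
      * apply le_join_r. eapply le_trans; [apply (top_greatest _ _ _ _ _ L) | exact Hz].
  - apply IH'; auto; lia.
Qed.

Lemma embed_reflects x y : le (f x) (f y) -> R x y.
Proof.
  intros Hle. apply NNPP. intros N.
  apply le_st_spec in Hle as [s Hs].
  destruct (mem_code (S (x + y)) (R x)) as [w Hw].
  pose proof (no_violation (pr (pr x y) (pr w s))) as V.
  apply not_true_iff_false in V. apply V, violation_spec.
  repeat (rewrite pi1_pr || rewrite pi2_pr). cbv zeta.
  repeat split.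
  - exact Hs.
  - apply Hw; [lia | ]. apply (preord_refl _ R_preord).
  - apply not_true_iff_false. rewrite Hw by lia. exact N.
  - intros p q Hp Hq Mp Hr. apply Hw; [lia | ]. apply Hw in Mp; [ | lia].
    apply (preord_trans _ R_preord) with p; auto. apply R_st_spec. eauto.
Qed.

End Play.

Context (le_st_oc : forall G A B C, ocomp G A -> ocomp G B -> ocomp G C ->
       odec G (fun g x => le_st (A g x) (B g x) (C g x))).
Context (R_st_oc : forall G A B C, ocomp G A -> ocomp G B -> ocomp G C ->
       odec G (fun g x => R_st (A g x) (B g x) (C g x))).

Lemma ocomp_verdict G :
  ocomp G (fun g z => verdict (embed g) (pi2 z)
     (pi1 (pi1 z)) (pi1 (pi2 (pi1 z))) (pi2 (pi2 (pi1 z)))).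
Proof.
  unfold verdict, violation, low, high. cbv zeta. ocomp_auto.
Qed.

End Strategy.
End Lattice.

Theorem theorem30 (meet join : nat -> nat -> nat) (bot top : nat)
    (le : nat -> nat -> Prop) :
  ei_prelattice meet join bot top le -> universal_preordering le.
Proof.
  intros [L EI].
  pose proof (bounded_prelattice _ _ _ _ _ L) as PL.
  pose proof (le_ce _ _ _ PL) as le_ce.
  split; [exact le_ce | ].
  intros R R_preord R_ce.
  destruct (ce_rel_stages le le_ce) as (le_st & le_st_spec & _ & le_st_oc).
  destruct (ce_rel_stages R R_ce) as (R_st & R_st_spec & R_st_mono & R_st_oc).
  assert (le_pre : forall a b : nat -> nat,
    ocomp Zero (fun _ => a) -> ocomp Zero (fun _ => b) -> ce (fun x => le (a x) (b x))).
  { intros a b Ha Hb. destruct le_ce as [u Hu].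
    apply ce_ext with (Q := fun x => W u (pr (a x) (b x))); [intros; apply Hu | ].
    apply (ce_preim (W u) (fun x => pr (a x) (b x))); [apply ce_W | ].
    apply (ocomp_pr Zero (fun _ => a) (fun _ => b)); auto. }
  destruct (ei_forcing (equiv_of le bot) (equiv_of le top)) as [G HG].
  - apply ce_and; apply le_pre; ocomp_auto.
  - apply ce_and; apply le_pre; ocomp_auto.
  - exact EI.
  - destruct (ocomp_search G (fun g k t =>
      verdict le_st R_st (embed meet join bot top g) t
        (pi1 k) (pi1 (pi2 k)) (pi2 (pi2 k)))) as [D HD].
    { now apply ocomp_verdict with (le := le). }
    destruct (HG D) as [e He].
    destruct (functional_choice _ He) as [g Hg].
    assert (Og : forall k, eval G (pr e k) (g k)) by apply Hg.
    destruct (ocomp_instance G (embed meet join bot top) e g) as [c Hc]; auto.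
    { apply (ocomp_embed meet join bot top le L). apply ocomp_id. }
    exists (embed meet join bot top g). split.
    + exists c. intros x y. split; [ | intros ->; apply Hc].
      intros Hy. exact (eval_functional _ _ _ _ Hy (Hc x)).
    + assert (bot_top : ~ le top bot).
      { intros H. destruct EI as [disj _]. apply (disj bot).
        split; split; auto; apply (bot_least _ _ _ _ _ L). }
      assert (ctl : forall n i j t v,
        verdict le_st R_st (embed meet join bot top g) t n i j = S v ->
        (forall m, m < t ->
          verdict le_st R_st (embed meet join bot top g) m n i j = 0) ->
        (v = 0 -> le (g (pr n (pr i j))) bot) /\
        (v = 1 -> le top (g (pr n (pr i j))))).
      { intros n i j t v Hv Hm. specialize (HD e g Og (pr n (pr i j)) t v).
        repeat (rewrite pi1_pr in HD || rewrite pi2_pr in HD).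
        specialize (HD Hv Hm). destruct (Hg (pr n (pr i j))) as (_ & H0 & H1).
        split; intros ->; [now apply H0 | now apply H1]. }
      intros x y. split.
      * intros Hxy. eapply embed_mono with (n := x + y); eauto; lia.
      * eapply embed_reflects; eauto.
Qed.
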